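(* Let $C=(c_1,c_2,\dots,c_r)$ be an ordered sequence of $r$ distinct positive integers, let $|C|=\sum_{i=1}^r c_i$, and let $$\mathbf{B}(C)=\{\mathbf{b}_\pi=(b_0,b_1,\dots,b_{|C|-1}) : \mathbf{b}_\pi \text{ is the sequence of coefficients of } g_{P_{\pi(C)}}(q),\ \pi\in\mathfrak{S}_r\}.$$ Then the poset $(\mathbf{B}(C),\preceq)$ is isomorphic to a refinement of the poset $(\mathfrak{S}_r,\le)$, where $\le$ is the weak order on $\mathfrak{S}_r$.
   Context: Let $P$ be a finite poset with $n$ elements. A labeling of $P$ is a bijection $L:P\to\{1,\dots,n\}$. $L$ is natural if $x<_P y$ implies $L(x)<L(y)$. The (extended) promotion $\partial L$ of a labeling $L$ is obtained as follows: (1) repeat until the element labeled $1$ is maximal: let $u$ be the element labeled $1$ and let $v$ be the element with the smallest label among all elements $v>_P u$; swap the labels of $u$ and $v$; (2) then simultaneously replace the label $1$ by $n$ and each label $i>1$ by $i-1$. The order of $L$ is the smallest $k\ge 0$ such that $\partial^k L$ is natural (it is known that the order is always at most $n-1$). The cumulative generating function of an $n$-element poset $P$ is $g_P(q)=\sum_{i=0}^{n-1}b_iq^i$, where $b_i=a_0+a_1+\cdots+a_i$ and $a_i$ is the number of labelings of $P$ of order exactly $i$. $T_k$ denotes the antichain on $k$ elements. The ordinal sum $P\oplus Q$ is the poset on the disjoint union $P\sqcup Q$ in which $s\le t$ iff $s,t\in P$ and $s\le_P t$, or $s,t\in Q$ and $s\le_Q t$, or $s\in P$ and $t\in Q$.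 For a sequence $D=(d_1,\dots,d_r)$ of positive integers, $P_D=\bigoplus_{i=1}^r T_{d_i}$. For $\pi\in\mathfrak{S}_r$ (the symmetric group on $\{1,\dots,r\}$), $\pi(C)=(c_{\pi(1)},\dots,c_{\pi(r)})$. Dominance order: for integer sequences $\mathbf{b}=(b_0,\dots,b_N)$ and $\mathbf{b}'=(b_0',\dots,b_N')$, $\mathbf{b}\preceq\mathbf{b}'$ means $b_i\le b_i'$ for all $i$. The weak order on $\mathfrak{S}_r$ is the partial order generated by the relations $p_1\cdots p_r\le p_1\cdots p_{i-1}p_{i+1}p_ip_{i+2}\cdots p_r$ (one-line notation) whenever $p_i<p_{i+1}$. A refinement of a poset $(S,\le)$ is a poset $(S,\le')$ on the same set such that $x\le y$ implies $x\le' y$. *)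

(* Defs.v *)
From HB Require Import structures.
From mathcomp Require Import all_boot all_order all_algebra all_fingroup.

Set Implicit Arguments.
Unset Strict Implicit.
Unset Printing Implicit Defensive.

Import Order.TTheory GRing.Theory Num.Theory.

Local Open Scope nat_scope.

Section Labelings.
Variables (d : Order.disp_t) (P : finPOrderType d).

(* Labels are shifted down by one: the label [i] in {1, ..., #|P|} is the
   ordinal with value [i - 1], so the label 1 is 0 and the label n is n - 1. *)
Definition labelings : {set {ffun P -> 'I_#|P|}} :=
  [set L : {ffun P -> 'I_#|P|} | injectiveb L].

Lemma labelingsP (L : {ffun P -> 'I_#|P|}) :
  reflect (bijective L) (L \in labelings).
Proof.
rewrite inE; apply: (iffP (injectiveP L)) => [Linj|/bij_inj //].
by apply: inj_card_bij Linj _; rewrite card_ord.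
Qed.

Definition natural (L : {ffun P -> 'I_#|P|}) : bool :=
  [forall x, forall y, (x < y)%O ==> (L x < L y)].

Definition slide_step (L : {ffun P -> 'I_#|P|}) : {ffun P -> 'I_#|P|} :=
  if [pick u | L u == 0 :> nat] is Some u then
    if [pick v | (u < v)%O && [forall w, (u < w)%O ==> (L v <= L w)]] is Some v
    then [ffun x => L (tperm u v x)]
    else L
  else L.

(* The smallest label moves strictly up at each effective step, so #|P|
   iterations suffice (see [slide_maximal]); the later ones do nothing. *)
Definition slide (L : {ffun P -> 'I_#|P|}) : {ffun P -> 'I_#|P|} :=
  iter #|P| slide_step L.

(* [ord_pred] sends 0 to #|P| - 1 and i > 0 to i - 1. *)
Definition promotion (L : {ffun P -> 'I_#|P|}) : {ffun P -> 'I_#|P|} :=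
  [ffun x => ord_pred (slide L x)].

Definition has_order (L : {ffun P -> 'I_#|P|}) (k : nat) : bool :=
  natural (iter k promotion L)
  && [forall j : 'I_k, ~~ natural (iter j promotion L)].

Definition order_count (i : nat) : nat := #|[set L in labelings | has_order L i]|.

Definition cumulative_count (i : nat) : nat := \sum_(j < i.+1) order_count j.

Definition cumulative_gf : {poly int} :=
  \poly_(i < #|P|) ((cumulative_count i)%:Z)%R.

Lemma slide_step_labelings L : L \in labelings -> slide_step L \in labelings.
Proof.
rewrite /slide_step; case: pickP => // u _; case: pickP => // v _.
rewrite !inE => /injectiveP Linj; apply/injectiveP => x y.
by rewrite !ffunE => /Linj /perm_inj.
Qed.

Lemma slide_maximal L u v :
  L \in labelings -> slide L u = 0 :> nat -> ~~ (u < v)%O.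
Proof.
move=> HL; rewrite /slide.
have step k : forall M w, M \in labelings -> M w = 0 :> nat ->
    #|[set y | (w < y)%O]| <= k ->
    forall u v, iter k slide_step M u = 0 :> nat -> ~~ (u < v)%O.
  elim: k => [|k IHk] M w HM Mw0 Hk u' v' => [Mu0|].
    have Minj : injective M by move: HM; rewrite inE => /injectiveP.
    have -> : u' = w by apply/Minj/val_inj; rewrite /= Mu0 Mw0.
    move: Hk; rewrite leqn0 cards_eq0 => /eqP/setP/(_ v').
    by rewrite !inE => ->.
  have Minj : injective M by move: HM; rewrite inE => /injectiveP.
  rewrite iterSr; have := slide_step_labelings HM.
  rewrite {1}/slide_step; have Sdef : slide_step M = slide_step M by [].
  move: Sdef; rewrite {2}/slide_step.
  case: pickP => [w' /eqP Mw'|/(_ w)]; last by rewrite Mw0.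
  have {w' Mw'} -> : w' = w by apply/Minj/val_inj; rewrite /= Mw' Mw0.
  case: pickP => [x /andP[wx _] -> HM'|nox -> _].
    apply: (IHk _ x HM'); first by rewrite ffunE tpermR.
    rewrite -ltnS; apply: leq_trans Hk; apply: proper_card.
    apply/properP; split; last by exists x; rewrite !inE ?ltxx.
    by apply/subsetP => y; rewrite !inE; apply: lt_trans.
  have max_w y : ~~ (w < y)%O.
    apply/negP => wy.
    case: (@arg_minnP _ y (fun z => (w < z)%O) (fun z => M z : nat) wy).
    move=> z wz zmin; have := nox z; rewrite wz /=.
    by move/negP; apply; apply/forallP => t; apply/implyP => /zmin.
  apply: (IHk _ w HM Mw0); rewrite (_ : [set y | _] = set0) ?cards0 //.
  by apply/setP => y; rewrite !inE (negbTE (max_w y)).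
case: (posnP #|P|) => [P0|Pgt0].
  by have := ltn_ord (L u); rewrite [X in _ < X]P0.
have /labelingsP[g _ gK] := HL.
have w0 : L (g (Ordinal Pgt0)) = 0 :> nat by rewrite gK.
by move=> h; apply: step HL w0 (max_card _) u v h.
Qed.

End Labelings.

Fact osum_display : Order.disp_t. Proof. exact: Order.Disp tt tt. Qed.

Definition antichain (k : nat) : Type := 'I_k.

Section Antichain.
Variable k : nat.
HB.instance Definition _ := Finite.on (antichain k).
Let le_refl : reflexive (@eq_op (antichain k)). Proof. exact: eqxx. Qed.
Let le_anti : antisymmetric (@eq_op (antichain k)).
Proof. by move=> x y /andP[/eqP]. Qed.
Let le_trans : transitive (@eq_op (antichain k)).
Proof. by move=> y x z /eqP->. Qed.
HB.instance Definition _ :=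
  Order.Le_isPOrder.Build osum_display (antichain k)
    le_refl le_anti le_trans.
End Antichain.

Definition ordinal_sum (P Q : Type) : Type := (P + Q)%type.

Section OrdinalSum.
Variables (d1 d2 : Order.disp_t) (P : finPOrderType d1) (Q : finPOrderType d2).
HB.instance Definition _ := Finite.copy (ordinal_sum P Q) (P + Q)%type.
Definition ordinal_sum_le (s t : ordinal_sum P Q) : bool :=
  match s, t with
  | inl x, inl y => (x <= y)%O
  | inr x, inr y => (x <= y)%O
  | inl _, inr _ => true
  | inr _, inl _ => false
  end.
Let le_refl : reflexive ordinal_sum_le.
Proof. by case=> x /=; exact: lexx. Qed.
Let le_anti : antisymmetric ordinal_sum_le.
Proof. by case=> x [] y //= /le_anti->. Qed.
Let le_trans : transitive ordinal_sum_le.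
Proof. by case=> y [] x [] z //=; exact: le_trans. Qed.
HB.instance Definition _ :=
  Order.Le_isPOrder.Build osum_display (ordinal_sum P Q)
    le_refl le_anti le_trans.
End OrdinalSum.

Fixpoint antichain_sum (D : seq nat) : finPOrderType osum_display :=
  if D is k :: D' then ordinal_sum (antichain k) (antichain_sum D')
  else antichain 0.

Definition permute_seq (r : nat) (C : r.-tuple nat) (p : 'S_r) : seq nat :=
  [seq tnth C (p i) | i <- enum 'I_r].

Definition coef_tuple (r : nat) (C : r.-tuple nat) (p : 'S_r) :
    (\sum_(c <- C) c).-tuple int :=
  [tuple ((cumulative_gf (antichain_sum (permute_seq C p)))`_i)%R
    | i < \sum_(c <- C) c].

Definition coef_tuples (r : nat) (C : r.-tuple nat) : Type :=
  {b : (\sum_(c <- C) c).-tuple int | b \in codom (coef_tuple C)}.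

Definition dominated (N : nat) (b b' : N.-tuple int) : bool :=
  [forall i, (tnth b i <= tnth b' i)%R].

(* Since [(s * t)%g x = t (s x)], the permutation [tperm i j * p] is [p] with
   the entries at positions [i] and [j] of its one-line notation swapped. *)
Definition weak_step (r : nat) : rel 'S_r := fun p q =>
  [exists i : 'I_r, exists j : 'I_r,
     [&& j == i.+1 :> nat, p i < p j & q == (tperm i j * p)%g]].

Definition weak_le (r : nat) : rel 'S_r := connect (@weak_step r).

Definition partial_order (T : Type) (le : rel T) : Prop :=
  [/\ reflexive le, antisymmetric le & transitive le].

Definition refinement (T : Type) (le le' : rel T) : Prop :=
  partial_order le' /\ subrel le le'.

Definition order_isomorphic (S T : Type) (leS : rel S) (leT : rel T) : Prop :=
  exists2 f : S -> T, bijective f & forall x y, leS x y = leT (f x) (f y).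

(* Main.v *)
From mathcomp Require Import all_boot all_order all_algebra all_fingroup zify.
Require Import Defs.

Set Implicit Arguments.
Unset Strict Implicit.
Unset Printing Implicit Defensive.

Import Order.TTheory.

(** Everything rests on a closed formula for the cumulative counts of an
    ordinal sum of antichains.  A labeling of [T_d (+) Q], with the antichain
    [T_d] at the bottom, is the same thing as the set of its bottom labels, an
    arrangement of them on [T_d], and the standardisation of its restriction to
    [Q], i.e. the labeling of [Q] with the same relative order.  When the least
    label (the ordinal 0) sits at the bottom, its first exchange is with the
    smallest label of [Q], which does not change the relative order on [Q];
    hence in every case the relative order on [Q] simply undergoes promotion in [Q]
    ([same_order_promotion]).  Meanwhile the largest bottom label drops by one
    per promotion until the bottom labels are the smallest ones
    ([bot_below_promotion]).  So the [k]-th promotion is natural exactly when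
    the [k]-th promotion of the standardisation is and the bottom labels lie
    among the [d + k] smallest ([natural_iter_promotion]), and counting gives
    [b_k(T_d (+) Q) = (d + min(k, |Q|))^_d * b_k(Q)]
    ([card_natural_iter_promotion]), with [^_] the falling factorial.

    By iteration [b_k(P_D)] is a product over the entries [d] of [D], in which
    [d] contributes [(d + min(k, s))^_d], where [s] is the sum of the entries
    after it.  Two facts about this product finish the proof.  Exchanging
    adjacent entries [a < b] into [b, a] increases it weakly for every [k]
    ([sorted_count_swap]), so creating an inversion moves up in the dominance
    order.  And the sequence of products determines [D] among the
    rearrangements of a multiset of positive integers ([sorted_count_inj]): if
    two rearrangements differ, let [M] be the sum of their longest common
    suffix; the products for [k = M + 1] reveal the entries just before it.
    Composing with the permutation that sorts [C] turns positions in [C] into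
    ranks, so that inversions mean the same thing in both orders. *)

(** * Products of falling factorials *)

Lemma leq_ffact d m n : m <= n -> m ^_ d <= n ^_ d.
Proof.
move=> le_mn; rewrite !ffact_prod; apply: leq_prod => i _.
exact: leq_sub2r.
Qed.

Lemma ffact_addl_fact d m : (d + m) ^_ d * m`! = (d + m)`!.
Proof. by rewrite -{2}[m](addKn d) ffact_fact ?leq_addr. Qed.

(** Both sides are [(a + b + m)! / m!]. *)
Lemma ffact_addl_comm a b m :
  (a + (b + m)) ^_ a * (b + m) ^_ b = (b + (a + m)) ^_ b * (a + m) ^_ a.
Proof.
apply/eqP; rewrite -(eqn_pmul2r (fact_gt0 m)) -!mulnA !ffact_addl_fact.
by rewrite addnCA.
Qed.

Lemma ffact_addl_succ d m :
  (d + m) ^_ d * (d + m.+1) = (d + m.+1) ^_ d * m.+1.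
Proof.
apply/eqP; rewrite -(eqn_pmul2r (fact_gt0 m)) -!mulnA -factS.
by rewrite ffact_addl_fact mulnCA ffact_addl_fact addnS -factS.
Qed.

(** After clearing denominators this says that
    [(a + m + j) ... (a + m + 1)] is at most [(b + m + j) ... (b + m + 1)]. *)
Lemma leq_ffact_exchange a b j m : a <= b ->
  (a + (j + m)) ^_ a * (b + m) ^_ b <= (b + (j + m)) ^_ b * (a + m) ^_ a.
Proof.
move=> le_ab; have pos : 0 < (j + m)`! * m`! by rewrite muln_gt0 !fact_gt0.
rewrite -(leq_pmul2r pos) !(mulnACA _ _ (j + m)`!) !ffact_addl_fact.
rewrite !(addnCA _ j) -!(ffact_addl_fact j) -!mulnA [X in _ <= _ * X]mulnC.
by rewrite leq_mul2r leq_ffact ?orbT // leq_add2l leq_add2r.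
Qed.

(** The number of labelings of the ordinal sum of antichains with sizes [D],
    first entry at the bottom, that are natural after [k] promotions; see
    [cumulative_count_antichain_sum]. *)
Fixpoint sorted_count (k : nat) (D : seq nat) : nat :=
  if D is d :: D' then (d + minn k (sumn D')) ^_ d * sorted_count k D' else 1.

Lemma sorted_count_gt0 k D : 0 < sorted_count k D.
Proof.
by elim: D => //= d D IHD; rewrite muln_gt0 IHD ffact_gt0 leq_addr.
Qed.

(** With [M] the sum of [D], the two sides agree for [k <= M] and for
    [k >= b + M].  For [M < k <= a + M] the claim is [leq_ffact_exchange].  At
    [k = a + M] the right side reaches its final value, while the left side
    keeps growing towards the same value until [k = b + M]. *)
Lemma sorted_count_swap k a b D :
  a <= b -> sorted_count k (a :: b :: D) <= sorted_count k (b :: a :: D).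
Proof.
move=> le_ab /=; rewrite !mulnA leq_pmul2r ?sorted_count_gt0 //.
set M := sumn D; case: (leqP k M) => [le_kM|lt_Mk].
  by rewrite !(minn_idPl (leq_trans le_kM (leq_addl _ _))) mulnC.
case: (leqP k (a + M)) => [le_kaM|/ltnW le_aMk].
  rewrite (minn_idPl (leq_trans le_kaM _)) ?leq_add2r //.
  by rewrite -(subnK (ltnW lt_Mk)); exact: leq_ffact_exchange.
rewrite -ffact_addl_comm; case: (leqP k (b + M)) => [le_kbM|//].
by rewrite leq_mul2r leq_ffact ?orbT // leq_add2l.
Qed.

Lemma sorted_count_cat2l k E D D' :
  sumn D = sumn D' -> sorted_count k D <= sorted_count k D' ->
  sorted_count k (E ++ D) <= sorted_count k (E ++ D').
Proof.
move=> eqs le; elim: E => //= e E IHE.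
by rewrite !sumn_cat eqs leq_mul2l IHE orbT.
Qed.

Lemma sorted_count_cat_small k E D : k <= sumn D ->
  sorted_count k (E ++ D) = (\prod_(e <- E) (e + k) ^_ e) * sorted_count k D.
Proof.
move=> le_k; elim: E => [|e E IHE] /=; first by rewrite big_nil mul1n.
rewrite big_cons IHE (minn_idPl _) ?mulnA //.
by rewrite sumn_cat (leq_trans le_k) ?leq_addl.
Qed.

(** At [k = sumn F + 1] only the factors of [F] and [x] are truncated, and the
    truncation divides the factor of [x] by [(x + k) / k].  The rest does not
    depend on the order of the entries, so the value reveals [x]. *)
Lemma sorted_count_last E x F : 0 < x ->
  let k := (sumn F).+1 in
  sorted_count k (rcons E x ++ F) * (x + k)
    = (\prod_(e <- rcons E x) (e + k) ^_ e) * (k * sorted_count k F).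
Proof.
move=> x_gt0 k; rewrite cat_rcons sorted_count_cat_small /=; last first.
  by rewrite /k; lia.
rewrite -cats1 big_cat big_seq1 /= -!mulnA; congr (_ * _).
by rewrite (minn_idPr (leqnSn _)) !mulnA mulnAC ffact_addl_succ.
Qed.

(** The last entries are recovered one at a time by [sorted_count_last], moving
    them from [E] and [E'] to the common suffix [F].  If a single entry is left
    there is nothing to recover; otherwise [sumn F + 1] is in range. *)
Lemma sorted_count_inj F E E' :
    perm_eq E E' -> (forall c, c \in E -> 0 < c) ->
    (forall k, k < sumn (E ++ F) ->
       sorted_count k (E ++ F) = sorted_count k (E' ++ F)) ->
  E = E'.
Proof.
elim/last_ind: E E' F => [|E x IHE] E' F.
  by rewrite perm_sym => /perm_nilP.
case/lastP: E' => [|E' y] pEE'.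
  by have /perm_size := pEE'; rewrite size_rcons.
move=> pos eqc; have x_gt0 : 0 < x by apply: pos; rewrite mem_rcons mem_head.
have y_gt0 : 0 < y.
  by apply: pos; rewrite (perm_mem pEE') mem_rcons mem_head.
have eq_xy : x = y.
  case: (posnP (sumn E)) => [E0|E_gt0].
    case: E {IHE} E0 pEE' pos {eqc} => [|e E] /= E0 pEE' pos; last first.
      by have := pos e (mem_head _ _); lia.
    move: pEE'; rewrite perm_sym => /perm_small_eq-/(_ isT).
    by move/(congr1 (last 0)); rewrite !last_rcons.
  have := eqc (sumn F).+1; rewrite cat_rcons sumn_cat /= -cat_rcons.
  move/(_ ltac:(lia)) => eqk.
  have := sorted_count_last E F x_gt0; rewrite /= eqk (perm_big _ pEE') /=.
  rewrite -(sorted_count_last E' F y_gt0) => /eqP.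
  by rewrite eqn_pmul2l ?sorted_count_gt0 // eqn_add2r => /eqP.
move: pEE' eqc pos; rewrite {}eq_xy => pEE' eqc pos; congr rcons.
apply: (IHE _ (y :: F)).
- by move: pEE'; rewrite -!cats1 perm_cat2r.
- by move=> c cE; apply: pos; rewrite mem_rcons inE cE orbT.
- by move=> k; rewrite -!cat_rcons; exact: eqc.
Qed.

(** * Promotion of a labeling *)

Section Promotion.
Variables (disp : Order.disp_t) (P : finPOrderType disp).
Implicit Type L : {ffun P -> 'I_#|P|}.

Lemma labelings_inj L : L \in labelings P -> injective L.
Proof. by rewrite inE => /injectiveP. Qed.

Lemma labeling_eq0 L u v :
  L \in labelings P -> L u = 0 :> nat -> (L v == 0 :> nat) = (v == u).
Proof.
move=> /labelings_inj Linj Lu0; rewrite -Lu0.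
by apply/eqP/eqP => [/val_inj/Linj|->].
Qed.

Lemma labeling_zero L (x : P) :
  L \in labelings P -> exists u, L u = 0 :> nat.
Proof.
move=> /labelingsP[g _ gK].
have P_gt0 : 0 < #|P| by apply/card_gt0P; exists x.
by exists (g (Ordinal P_gt0)); rewrite gK.
Qed.

Lemma iter_slide_step_labelings j L :
  L \in labelings P -> iter j (@slide_step _ P) L \in labelings P.
Proof. by move=> HL; elim: j => //= j; exact: slide_step_labelings. Qed.

Lemma slide_labelings L : L \in labelings P -> slide L \in labelings P.
Proof. exact: iter_slide_step_labelings. Qed.

Lemma slide_step_swap L u v :
    L \in labelings P -> L u = 0 :> nat -> (u < v)%O ->
    (forall w, (u < w)%O -> L v <= L w) ->
  slide_step L = [ffun x => L (tperm u v x)].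
Proof.
move=> HL Lu0 uv vmin; rewrite /slide_step.
case: pickP => [u'|/(_ u)]; last by rewrite Lu0.
rewrite (labeling_eq0 _ HL Lu0) => /eqP->.
case: pickP => [v' /andP[uv' /forallP v'min]|/(_ v)]; last first.
  by rewrite uv /= => /negbT/negP[]; apply/forallP => w; apply/implyP/vmin.
suff -> : v' = v by [].
apply/(labelings_inj HL)/val_inj/eqP; rewrite eqn_leq vmin // andbT.
exact: (implyP (v'min v)).
Qed.

Lemma slide_step_max L u :
    L \in labelings P -> L u = 0 :> nat -> (forall v, ~~ (u < v)%O) ->
  slide_step L = L.
Proof.
move=> HL Lu0 umax; rewrite /slide_step; case: pickP => // u'.
rewrite (labeling_eq0 _ HL Lu0) => /eqP->.
by case: pickP => // v; rewrite (negbTE (umax v)).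
Qed.

Lemma slide_step_slide L : L \in labelings P -> slide_step (slide L) = slide L.
Proof.
move=> HL; rewrite {1}/slide_step; case: pickP => // u /eqP Lu0.
by case: pickP => // v /andP[]; rewrite (negbTE (slide_maximal v HL Lu0)).
Qed.

(** Sliding is stationary once the label 0 is maximal, so the number of steps
    may be chosen freely above [#|P|]. *)
Lemma iter_slide_step j L : L \in labelings P -> #|P| <= j ->
  iter j (@slide_step _ P) L = slide L.
Proof.
move=> HL /subnK<-; rewrite iterD -/(slide L).
by elim: (j - #|P|) => //= i ->; exact: slide_step_slide.
Qed.

Lemma val_ord_pred n (i : 'I_n) :
  ord_pred i = (if i == 0 :> nat then n.-1 else i.-1) :> nat.
Proof.
case: n i => [[]//|n] i; rewrite /ord_pred /=.
case: (i =P 0 :> nat) => [->|/eqP]; first by rewrite add0n modn_small.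
rewrite -lt0n => i_gt0; rewrite -subn1 addnC -addnBA // modnDl subn1.
by rewrite modn_small // (leq_ltn_trans (leq_pred _)).
Qed.

(** Cyclic decrement keeps the order except that 0 becomes the largest. *)
Lemma ltn_ord_pred n (i j : 'I_n) :
  (ord_pred i < ord_pred j)
    = (i != 0 :> nat) && ((j == 0 :> nat) || (i < j)).
Proof.
rewrite !val_ord_pred; have [lt_i lt_j] := (ltn_ord i, ltn_ord j).
by case: eqP => i0; case: eqP => j0 /=; lia.
Qed.

Lemma promotion_labelings L : L \in labelings P -> promotion L \in labelings P.
Proof.
move=> HL; have /labelings_inj Sinj := slide_labelings HL.
rewrite inE; apply/injectiveP => x y; rewrite !ffunE => e; apply/Sinj/ord_inj.
move/(congr1 (@nat_of_ord _)): e; rewrite !val_ord_pred.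
have [lt_x lt_y] := (ltn_ord (slide L x), ltn_ord (slide L y)).
by case: eqP => x0; case: eqP => y0; lia.
Qed.

Lemma iter_promotion_labelings k L :
  L \in labelings P -> iter k (@promotion _ P) L \in labelings P.
Proof. by move=> HL; elim: k => //= k; exact: promotion_labelings. Qed.

(** Once naturality persists under promotion, having order at most [k] means
    being natural after exactly [k] promotions. *)
Lemma cumulative_countE k :
    (forall L, L \in labelings P -> natural L -> natural (promotion L)) ->
  cumulative_count P k
    = #|[set L in labelings P | natural (iter k (@promotion _ P) L)]|.
Proof.
move=> persist.
have mono L j i : L \in labelings P -> j <= i ->
    natural (iter j (@promotion _ P) L) -> natural (iter i (@promotion _ P) L).
  move=> HL /subnK<-; rewrite iterD.
  elim: (i - j) => //= l IHl /IHl; apply: persist.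
  exact/iter_promotion_labelings/iter_promotion_labelings.
rewrite /cumulative_count; elim: k => [|k IHk].
  rewrite big_ord1; apply: eq_card => L; rewrite !inE /has_order /=.
  by rewrite (_ : [forall j : 'I_0, _]) ?andbT //; apply/forallP; case.
rewrite big_ord_recr {}IHk /= /order_count -cardsUI.
rewrite [X in _ + X](_ : _ = 0) ?addn0; last first.
  apply: eq_card0 => L; rewrite !inE /has_order.
  apply/negP => /andP[/andP[_ nk] /andP[_ /andP[_ /forallP]]].
  by move/(_ ord_max); rewrite nk.
apply: eq_card => L; rewrite !inE -andb_orr; apply: andb_id2l => HL.
have {}HL : L \in labelings P by rewrite inE.
rewrite /has_order.
apply/orP/idP => [[/(mono _ _ _ HL (leqnSn k))|/andP[]]|] //.
move=> nS; case nk: (natural (iter k _ L)); [by left|right].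
rewrite nS; apply/forallP => j; apply: contraFN nk => nj.
by apply: mono nj => //; rewrite -ltnS.
Qed.

End Promotion.

(** * Promotion on an ordinal sum with an antichain at the bottom *)

Section OrdinalSumPromotion.
Variables (d : nat) (disp : Order.disp_t) (Q : finPOrderType disp).

Local Notation S := (ordinal_sum (antichain d) Q : finPOrderType osum_display).
Local Notation n := #|S|.
Local Notation m := #|Q|.
Local Notation bot x := (inl x : S).
Local Notation top y := (inr y : S).
Implicit Types (L : {ffun S -> 'I_n}) (M : {ffun Q -> 'I_m}).

Lemma card_ordinal_sum_antichain : n = d + m.
Proof. by rewrite [LHS]card_sum; congr (_ + _); exact: card_ord. Qed.

Lemma lt_top x y : (top x < top y)%O = (x < y)%O.
Proof. by rewrite !lt_def. Qed.

Lemma lt_bot_top (x : antichain d) y : (bot x < top y)%O.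
Proof. by rewrite lt_def. Qed.

Lemma lt_top_bot y (x : antichain d) : (top y < bot x)%O = false.
Proof. by rewrite lt_def andbF. Qed.

Lemma lt_bot (x y : antichain d) : (bot x < bot y)%O = false.
Proof.
by rewrite lt_def; apply/negP => /andP[/negP ne /eqP e]; apply: ne; rewrite e.
Qed.

(** Pigeonhole: the [t] smallest labels are then all on the bottom antichain. *)
Lemma top_labels_ge L t : L \in labelings S ->
  t <= n -> (forall y, t <= L (top y)) -> t <= d.
Proof.
move=> /labelingsP[g Lg gL] le_tn ge_t.
have bot_g (i : 'I_t) : exists x : antichain d, g (widen_ord le_tn i) = bot x.
  case eg: (g _) => [x|y]; first by exists x.
  by have := ge_t y; rewrite -eg gL leqNgt /= ltn_ord.
have [h hE] := fin_all_exists bot_g.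
rewrite -[t]card_ord -[d]card_ord; apply: (@leq_card _ (antichain d) h).
move=> i j hij; apply/val_inj => /=.
have := congr1 L (hE i); rewrite hij -hE !gL.
by move/(congr1 (@nat_of_ord _)).
Qed.

(** Pigeonhole: the bottom antichain already uses up the [d] smallest labels. *)
Lemma bot_labels_lt L : L \in labelings S ->
  (forall x, L (bot x) < d) -> forall y, d <= L (top y).
Proof.
move=> /labelings_inj Linj lt_d y; rewrite leqNgt; apply/negP => lt_yd.
pose f (x : option (antichain d)) : 'I_d :=
  if x is Some x then Ordinal (lt_d x) else Ordinal lt_yd.
suff /leq_card : injective f by rewrite card_option !card_ord ltnn.
by case=> [x|] [z|] // /(congr1 val) /= /val_inj/Linj // [->].
Qed.

(** [M] is the standardisation of the restriction of [L] to [Q].  Stated as a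
    relation, it can be followed through a slide without computing ranks. *)
Definition same_order L M :=
  forall x y, (M x < M y) = (L (top x) < L (top y)).

Lemma same_order_zero L M u : L \in labelings S -> M \in labelings Q ->
  same_order L M -> L (top u) = 0 :> nat -> M u = 0 :> nat.
Proof.
move=> HL HM LM Lu0; have [v Mv0] := labeling_zero u HM.
suff -> : u = v by [].
apply/eqP; rewrite -(labeling_eq0 _ HM Mv0) eqn0Ngt -Mv0.
by rewrite LM Lu0.
Qed.

(** Once the label 0 is in [Q], both slides follow the same path and the bottom
    labels are left alone. *)
Lemma same_order_step L M u : L \in labelings S -> M \in labelings Q ->
    same_order L M -> L (top u) = 0 :> nat ->
  [/\ same_order (slide_step L) (slide_step M),
      exists u', slide_step L (top u') = 0 :> nat &
      forall x, slide_step L (bot x) = L (bot x)].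
Proof.
move=> HL HM LM Lu0; have Mu0 := same_order_zero HL HM LM Lu0.
case: (pickP (fun v => (u < v)%O)) => [v0 uv0|umax]; last first.
  have umax' v : ~~ (u < v)%O by rewrite umax.
  rewrite (slide_step_max HM Mu0) // (slide_step_max HL Lu0); last first.
    by case=> v; rewrite ?lt_top_bot ?lt_top.
  by split=> //; exists u.
case: (@arg_minnP _ v0 (fun v => (u < v)%O) (fun v => M v : nat) uv0).
move=> v uv vmin; rewrite (slide_step_swap HM Mu0 uv vmin).
rewrite (@slide_step_swap _ _ L (top u) (top v)) ?lt_top //; last first.
  case=> w; rewrite ?lt_top_bot ?lt_top // => uw.
  by rewrite leqNgt -LM -leqNgt vmin.
have tpermE x : tperm (top u) (top v) (top x) = top (tperm u v x).
  by symmetry; apply: inj_tperm => ? ? [].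
split=> [x y||x].
- by rewrite !ffunE !tpermE LM.
- by exists v; rewrite ffunE tpermR.
- by rewrite ffunE tpermD.
Qed.

Lemma same_order_iter_step j L M u : L \in labelings S -> M \in labelings Q ->
    same_order L M -> L (top u) = 0 :> nat ->
  [/\ same_order (iter j (@slide_step _ S) L) (iter j (@slide_step _ Q) M),
      exists u', iter j (@slide_step _ S) L (top u') = 0 :> nat &
      forall x, iter j (@slide_step _ S) L (bot x) = L (bot x)].
Proof.
move=> HL HM LM Lu0; elim: j => [|j [LMj [v Lv0] Lj]] /=.
  by split=> //; exists u.
have [H1 H2 H3] := same_order_step (iter_slide_step_labelings j HL)
                     (iter_slide_step_labelings j HM) LMj Lv0.
by split=> // x; rewrite H3.
Qed.

Lemma step_bot L u v : L \in labelings S ->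
    L (bot u) = 0 :> nat -> (forall w, L (top v) <= L (top w)) ->
  slide_step L = [ffun x => L (tperm (bot u) (top v) x)].
Proof.
move=> HL Lu0 vmin; apply: (slide_step_swap HL Lu0); first exact: lt_bot_top.
by case=> w; rewrite ?lt_bot.
Qed.

(** If 0 starts at the bottom, one extra step brings it into [Q], where it
    replaces the smallest label of [Q] and so keeps the relative order there;
    the bottom receives that smallest label in exchange for 0. *)
Lemma same_order_slide L M (y0 : Q) : L \in labelings S -> M \in labelings Q ->
  same_order L M ->
  [/\ same_order (slide L) (slide M),
      exists u, slide L (top u) = 0 :> nat &
      exists2 v, forall w, L (top v) <= L (top w) &
        forall x, slide L (bot x) =
                  if L (bot x) == 0 :> nat then L (top v) else L (bot x)].
Proof.
move=> HL HM LM.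
have [v vmin] : exists v, forall w, L (top v) <= L (top w).
  case: (@arg_minnP _ y0 predT (fun w => L (top w) : nat) isT) => v _ vmin.
  by exists v => w; apply: vmin.
have le_mn : m <= n by rewrite card_ordinal_sum_antichain leq_addl.
rewrite -(iter_slide_step HL (leqnSn n)) iterSr.
have HS := slide_step_labelings HL.
have [[u|u] Lu0] := labeling_zero (top y0) HL.
  have eqS := step_bot HL Lu0 vmin.
  have tperm_top x :
      tperm (bot u) (top v) (top x) = if x == v then bot u else top x.
    case: (x =P v) => [->|ne]; first by rewrite tpermR.
    by rewrite tpermD //; apply/eqP; case=> /esym.
  have SM : same_order (slide_step L) M.
    move=> x y; rewrite LM eqS !ffunE !tperm_top.
    have := vmin x; have := vmin y.
    have vpos : 0 < L (top v) by rewrite lt0n (labeling_eq0 _ HL Lu0).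
    have top_inj z : L (top z) = L (top v) :> nat -> z = v.
      by move/val_inj/(labelings_inj HL) => [].
    case: (x =P v) => [->|_]; case: (y =P v) => [->|ne_yv] le_y le_x //.
    - by rewrite !ltnn.
    - rewrite Lu0 (leq_trans vpos le_y) ltn_neqAle le_y andbT eq_sym.
      by apply/eqP => /top_inj.
    - by rewrite Lu0 ltn0 ltnNge le_x.
  have Sv0 : slide_step L (top v) = 0 :> nat by rewrite eqS ffunE tpermR.
  rewrite -(iter_slide_step HM le_mn).
  have [H1 H2 H3] := same_order_iter_step n HS HM SM Sv0.
  split=> //; exists v => // x; rewrite H3 eqS ffunE (labeling_eq0 _ HL Lu0).
  case: (bot x =P bot u) => [->|/eqP ne]; first by rewrite tpermL.
  by rewrite tpermD // eq_sym.
rewrite -(iter_slide_step HM (leqW le_mn)) iterSr.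
have [H1 [u' u'0] H3] := same_order_step HL HM LM Lu0.
have [H4 H5 H6] :=
  same_order_iter_step n HS (slide_step_labelings HM) H1 u'0.
split=> //; exists v => // x; rewrite H6 H3.
by rewrite (labeling_eq0 _ HL Lu0).
Qed.

Lemma same_order_promotion L M : L \in labelings S -> M \in labelings Q ->
  same_order L M -> same_order (promotion L) (promotion M).
Proof.
move=> HL HM LM x y.
have [H [u Lu0] _] := same_order_slide x HL HM LM.
have [HSL HSM] := (slide_labelings HL, slide_labelings HM).
have Mu0 := same_order_zero HSL HSM H Lu0.
rewrite !ffunE !ltn_ord_pred !(labeling_eq0 _ HSL Lu0).
by rewrite !(labeling_eq0 _ HSM Mu0) !(inj_eq (@inr_inj _ _)) H.
Qed.

Lemma same_order_iter_promotion k L M :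
    L \in labelings S -> M \in labelings Q -> same_order L M ->
  same_order (iter k (@promotion _ S) L) (iter k (@promotion _ Q) M).
Proof.
move=> HL HM LM; elim: k => //= k.
by apply: same_order_promotion; apply: iter_promotion_labelings.
Qed.

Definition bot_below t L := [forall x : antichain d, L (bot x) < t].

(** Every bottom label decreases by one, except that a bottom label 0 becomes
    the smallest label of [Q] minus one.  The latter is smaller than the largest
    bottom label unless the bottom labels are the [d] smallest ones, in which
    case it equals [d - 1]. *)
Lemma bot_below_promotion L M (y0 : Q) t :
    L \in labelings S -> M \in labelings Q -> same_order L M -> d <= t ->
  bot_below t (promotion L) = bot_below t.+1 L.
Proof.
move=> HL HM LM le_dt.
have [_ [u u0] [v vmin sbot]] := same_order_slide y0 HL HM LM.
have botE x : promotion L (bot x) =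
    (if L (bot x) == 0 :> nat then L (top v) else L (bot x)).-1 :> nat.
  rewrite ffunE val_ord_pred (labeling_eq0 _ (slide_labelings HL) u0) sbot.
  by case: ifP.
have t_gt0 (x : antichain d) : 0 < t.
  exact: leq_trans (leq_ltn_trans (leq0n x) (ltn_ord x)) le_dt.
have lt_predE k : 0 < t -> (k.-1 < t) = (k < t.+1) by case: k.
apply/forallP/forallP => below x.
  have := below x; rewrite botE lt_predE ?t_gt0 //.
  by case: eqP => [->|].
rewrite botE lt_predE ?t_gt0 //; case: ifP => // _.
(* Otherwise the [t + 1 > d] smallest labels would all be at the bottom. *)
rewrite ltnS leqNgt; apply/negP => lt_tv.
have ge_t y : t < L (top y) by exact: leq_trans (vmin y).
have := top_labels_ge HL (ltn_trans lt_tv (ltn_ord _)) ge_t.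
by rewrite ltnNge le_dt.
Qed.

Lemma natural_same_order L M : L \in labelings S -> M \in labelings Q ->
  same_order L M -> natural L = bot_below d L && natural M.
Proof.
move=> HL HM LM; apply/forallP/andP => [natL|[bL natM] p].
  have natE p q : (p < q)%O -> L p < L q.
    by move=> pq; have /forallP/(_ q)/implyP/(_ pq) := natL p.
  split.
    apply/forallP => x; rewrite ltnNge; apply/negP => le_dx.
    have ge_d y : d < L (top y).
      exact: leq_ltn_trans le_dx (natE _ _ (lt_bot_top x y)).
    have := top_labels_ge HL (leq_ltn_trans le_dx (ltn_ord _)) ge_d.
    by rewrite ltnn.
  apply/forallP => x; apply/forallP => y; apply/implyP => xy.
  by rewrite LM natE ?lt_top.
apply/forallP => q; apply/implyP; case: p q => [x|x] [y|y].
- by rewrite lt_bot.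
- move=> _; apply: leq_trans (forallP bL x) _.
  exact: bot_labels_lt HL (fun z => forallP bL z) y.
- by rewrite lt_top_bot.
- rewrite lt_top -LM => xy.
  by have /forallP/(_ y)/implyP/(_ xy) := forallP natM x.
Qed.

(** This iterates [bot_below_promotion].  That lemma needs a point of [Q]; if
    [Q] is empty, both conditions on the right hold for every labeling. *)
Lemma natural_iter_promotion k L M :
    L \in labelings S -> M \in labelings Q -> same_order L M ->
  natural (iter k (@promotion _ S) L)
    = bot_below (d + k) L && natural (iter k (@promotion _ Q) M).
Proof.
move=> HL HM LM.
rewrite (natural_same_order (iter_promotion_labelings k HL)
  (iter_promotion_labelings k HM) (same_order_iter_promotion k HL HM LM)).
congr (_ && _); case: (pickP (@predT Q)) => [y0 _|Q0]; last first.
  have nd : n = d by rewrite card_ordinal_sum_antichain (eq_card0 Q0) addn0.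
  transitivity true; [|symmetry]; apply/forallP => x.
    by rewrite -[X in _ < X]nd.
  by apply: leq_trans (ltn_ord _) _; rewrite nd leq_addr.
elim: k L M HL HM LM => [|k IHk] L M HL HM LM; first by rewrite addn0.
rewrite iterSr.
rewrite (IHk _ (promotion M) (promotion_labelings HL) (promotion_labelings HM)).
  by rewrite addnS (bot_below_promotion y0 HL HM LM) ?leq_addr.
exact: same_order_promotion.
Qed.

End OrdinalSumPromotion.

(** * Counting labelings by the number of promotions needed *)

Lemma card_labelings (disp : Order.disp_t) (P : finPOrderType disp) :
  #|labelings P| = #|P|`!.
Proof. by rewrite card_inj_ffuns card_ord ffactnn. Qed.

Section OrdinalSumCount.
Variables (d : nat) (disp : Order.disp_t) (Q : finPOrderType disp).

Local Notation S := (ordinal_sum (antichain d) Q : finPOrderType osum_display).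
Local Notation n := #|S|.
Local Notation m := #|Q|.
Local Notation bot x := (inl x : S).
Local Notation top y := (inr y : S).
Implicit Types (L : {ffun S -> 'I_n}) (M : {ffun Q -> 'I_m}).

Definition top_count L (v : nat) := #|[set y : Q | L (top y) < v]|.

Lemma top_count_lt L x v : L (top x) < v ->
  top_count L (L (top x)) < top_count L v.
Proof.
move=> lt_xv; apply: proper_card; apply/properP; split.
  by apply/subsetP => y; rewrite !inE => /ltn_trans; apply.
by exists x; rewrite !inE ?ltnn.
Qed.

Lemma top_count_lt_card L x : top_count L (L (top x)) < m.
Proof.
exact: leq_trans (top_count_lt (ltn_ord (L (top x)))) (max_card _).
Qed.

Definition standardize L : {ffun Q -> 'I_m} :=
  [ffun x => Ordinal (top_count_lt_card L x)].

Lemma same_order_standardize L : same_order L (standardize L).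
Proof.
move=> x y; rewrite !ffunE /=; apply/idP/idP; last exact: top_count_lt.
apply: contraTT; rewrite -!leqNgt => le_yx; apply: subset_leq_card.
by apply/subsetP => z; rewrite !inE => /leq_trans; apply.
Qed.

Lemma standardize_labelings L :
  L \in labelings S -> standardize L \in labelings Q.
Proof.
move=> /labelings_inj Linj; rewrite inE; apply/injectiveP => x y eq_xy.
have [Hxy Hyx] := (same_order_standardize L x y, same_order_standardize L y x).
move: Hxy Hyx; rewrite eq_xy ltnn => /esym/negbT ge_xy /esym/negbT ge_yx.
apply/inr_inj/Linj/val_inj/eqP.
by rewrite eqn_leq [_ <= _]leqNgt ge_yx leqNgt ge_xy.
Qed.

Definition split_labeling L : {ffun antichain d -> 'I_n} * {ffun Q -> 'I_m} :=
  ([ffun x => L (bot x)], standardize L).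

(** The labels below [v] number [min(v, n)] in total, so those on [Q] are
    determined by those at the bottom. *)
Lemma top_count_bot L L' v : L \in labelings S -> L' \in labelings S ->
  (forall x, L (bot x) = L' (bot x)) -> top_count L v = top_count L' v.
Proof.
have countE K : K \in labelings S ->
    #|[set x : antichain d | K (bot x) < v]| + top_count K v
      = #|[set i : 'I_n | i < v]|.
  move=> HK; have Kbij : bijective K by apply/labelingsP.
  rewrite -(on_card_preimset (f := K)); last exact: onW_bij.
  rewrite -[RHS]sum1_card big_sumType /= /top_count -!sum1_card.
  by congr (_ + _); apply: eq_bigl => z; rewrite !inE.
move=> HL HL' eqb; apply: (@addnI #|[set x : antichain d | L (bot x) < v]|).
rewrite countE // -(countE _ HL'); congr (_ + _).
by apply: eq_card => x; rewrite !inE eqb.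
Qed.

(** The bottom labels determine the set of labels used on [Q], and the
    standardisation then says where each of them goes. *)
Lemma split_labeling_inj : {in labelings S &, injective split_labeling}.
Proof.
move=> L L' HL HL' [/ffunP eqb eqt].
have {}eqb x : L (bot x) = L' (bot x) by have := eqb x; rewrite !ffunE.
apply/ffunP => -[x|x]; first exact: eqb.
have eqc v := top_count_bot v HL HL' eqb.
have := congr1 (fun M : {ffun _ -> _} => nat_of_ord (M x)) eqt.
rewrite !ffunE /= => eqx; apply/val_inj/eqP; case: ltngtP => // /top_count_lt.
  by rewrite eqx -eqc ltnn.
by rewrite -eqx eqc ltnn.
Qed.

(** An injection between sets of the same size
    [n! = (n! / m!) * m!] is onto. *)
Lemma split_labeling_image :
  split_labeling @: labelings S
    = setX [set b : {ffun antichain d -> 'I_n} | injectiveb b] (labelings Q).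
Proof.
apply/eqP; rewrite eqEcard (card_in_imset split_labeling_inj) cardsX.
rewrite card_inj_ffuns !card_labelings !card_ord.
apply/andP; split.
  apply/subsetP => _ /imsetP[L HL ->]; rewrite in_setX standardize_labelings //.
  rewrite andbT inE; apply/injectiveP => x y; rewrite !ffunE.
  by move/(labelings_inj HL) => [].
have le_dn : d <= n by rewrite card_ordinal_sum_antichain leq_addr.
by rewrite -(ffact_fact le_dn) card_ordinal_sum_antichain addKn.
Qed.

(** Through [split_labeling] the criterion of [natural_iter_promotion] becomes a
    pair of independent conditions: the bottom labels form an injection into the
    [min(d + k, n) = d + min(k, m)] smallest labels, and the standardisation is
    natural after [k] promotions. *)
Lemma card_natural_iter_promotion k :
  #|[set L in labelings S | natural (iter k (@promotion _ S) L)]|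
    = (d + minn k m) ^_ d
      * #|[set M in labelings Q | natural (iter k (@promotion _ Q) M)]|.
Proof.
pose small := [pred i : 'I_n | i < d + k].
have natE L : L \in labelings S -> natural (iter k (@promotion _ S) L)
    = bot_below (d + k) L && natural (iter k (@promotion _ Q) (standardize L)).
  move=> HL; apply: natural_iter_promotion => //.
    exact: standardize_labelings.
  exact: same_order_standardize.
have botE L : bot_below (d + k) L = ((split_labeling L).1 \in ffun_on small).
  by apply/forallP/ffun_onP => b x; have := b x; rewrite !ffunE.
rewrite -(card_in_imset (f := split_labeling)); last first.
  by move=> L L' /setIdP[HL _] /setIdP[HL' _]; exact: split_labeling_inj.
have -> : (d + minn k m) ^_ d =
    #|[set b : {ffun antichain d -> 'I_n} in ffun_on small | injectiveb b]|.
  rewrite card_inj_ffuns_on card_ord; congr (_ ^_ _).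
  have le_n : d + minn k m <= n.
    by rewrite card_ordinal_sum_antichain leq_add2l geq_minr.
  rewrite -[LHS]card_ord -[LHS]sum1_card -[RHS]sum1_card.
  rewrite (big_ord_widen n (fun=> 1)) //.
  apply: eq_bigl => i.
  by rewrite inE addn_minr -card_ordinal_sum_antichain leq_min ltn_ord andbT.
rewrite -cardsX; apply: eq_card => -[b M]; rewrite in_setX !in_set.
apply/imsetP/andP => [[L]|[/andP[bS binj] /andP[HM nM]]].
  rewrite inE => /andP[HL]; rewrite natE // botE => /andP[bS nM] [-> ->].
  have : split_labeling L \in split_labeling @: labelings S by exact: imset_f.
  by rewrite split_labeling_image in_setX !in_set /= bS nM => /andP[-> ->].
have : (b, M) \in split_labeling @: labelings S.
  by rewrite split_labeling_image in_setX !in_set binj.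
case/imsetP => L HL eqL; exists L => //; rewrite inE HL natE //.
by rewrite botE -eqL /= bS; case: eqL => _ <-.
Qed.

End OrdinalSumCount.

Lemma card_antichain_sum D : #|antichain_sum D| = sumn D.
Proof.
elim: D => [|d D IHD] /=; first exact: card_ord.
by rewrite card_ordinal_sum_antichain IHD.
Qed.

(** Compare [natural_iter_promotion] for [k = 0] and [k = 1]. *)
Lemma promotion_natural D
    (L : {ffun antichain_sum D -> 'I_#|antichain_sum D|}) :
  L \in labelings (antichain_sum D) -> natural L -> natural (promotion L).
Proof.
elim: D L => [|d D IHD] L HL.
  by move=> _; apply/forallP => -[].
have [HM LM] := (standardize_labelings HL, same_order_standardize L).
have := natural_iter_promotion 0 HL HM LM; rewrite /= addn0 => ->.
have := natural_iter_promotion 1 HL HM LM; rewrite /= => ->.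
case/andP => /forallP bL natM; apply/andP; split; last exact: IHD.
by apply/forallP => x; apply: leq_trans (bL x) (leq_addr _ _).
Qed.

Lemma cumulative_count_antichain_sum k D :
  cumulative_count (antichain_sum D) k = sorted_count k D.
Proof.
rewrite cumulative_countE; last exact: promotion_natural.
elim: D => [|d D IHD] /=; last first.
  by rewrite card_natural_iter_promotion IHD card_antichain_sum.
rewrite (_ : [set L in _ | _] = labelings (antichain 0)); last first.
  by apply/setP => L; rewrite inE; apply: andb_idr => _; apply/forallP => -[].
by rewrite card_labelings card_ord.
Qed.

(** * Rearrangements of C and the weak order *)

Section Permutations.
Variables (r : nat) (C : r.-tuple nat).
Hypotheses (C_distinct : uniq C) (C_positive : forall c, c \in C -> 0 < c).
Implicit Types p q : 'S_r.

Lemma perm_permute_seq p : perm_eq (permute_seq C p) C.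
Proof.
by apply/tuple_permP; exists p.
Qed.

Lemma sumn_permute_seq p : sumn (permute_seq C p) = \sum_(c <- C) c.
Proof. by rewrite (perm_sumn (perm_permute_seq p)) sumnE. Qed.

Lemma permute_seq_inj : injective (permute_seq C).
Proof.
move=> p q /eq_in_map eq_pq; apply/permP => i.
by apply: (tuple_uniqP _ C_distinct); apply: eq_pq; rewrite mem_enum.
Qed.

Lemma tnth_coef_tuple p (i : 'I_(\sum_(c <- C) c)) :
  tnth (coef_tuple C p) i = ((sorted_count i (permute_seq C p))%:Z)%R.
Proof.
rewrite tnth_mktuple coef_poly card_antichain_sum sumn_permute_seq ltn_ord.
by rewrite cumulative_count_antichain_sum.
Qed.

Lemma dominated_coef_tuple p q :
  reflect (forall k, k < \sum_(c <- C) c ->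
             sorted_count k (permute_seq C p)
               <= sorted_count k (permute_seq C q))
          (dominated (coef_tuple C p) (coef_tuple C q)).
Proof.
apply: (iffP forallP) => [le k lt_k|le i].
  by have := le (Ordinal lt_k); rewrite !tnth_coef_tuple lez_nat.
by rewrite !tnth_coef_tuple lez_nat le.
Qed.

Lemma coef_tuple_inj : injective (coef_tuple C).
Proof.
move=> p q eq_pq; apply: permute_seq_inj.
apply: (@sorted_count_inj [::]).
- by rewrite (permPl (perm_permute_seq p)) perm_sym perm_permute_seq.
- by move=> c; rewrite (perm_mem (perm_permute_seq p)); exact: C_positive.
move=> k; rewrite !cats0 sumn_permute_seq => lt_k.
have := congr1 (fun b => tnth b (Ordinal lt_k)) eq_pq.
by rewrite !tnth_coef_tuple => -[].
Qed.

Lemma exists_sorting_perm :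
  exists t : 'S_r, {homo (fun i => tnth C (t i)) : i j / i < j}.
Proof.
have /tuple_permP[t sortE] : perm_eq (sort leq C) C by rewrite perm_sort.
exists t => i j lt_ij.
have srt : sorted ltn (sort leq C).
  rewrite ltn_sorted_uniq_leq sort_uniq C_distinct /=.
  exact: (sort_sorted leq_total).
have nthE (k : 'I_r) : nth 0 (sort leq C) k = tnth C (t k).
  by rewrite sortE -tnth_nth tnth_mktuple.
have szC : size (sort leq C) = r by rewrite size_sort size_tuple.
by rewrite -!nthE; apply: (sorted_ltn_nth ltn_trans); rewrite ?inE ?szC.
Qed.

(** Through the sorting permutation [t] the values of [p] become ranks, so an
    ascent of [p] is a pair of adjacent sizes in ascending order. *)
Lemma weak_step_dominated (t p q : 'S_r) :
    {homo (fun i => tnth C (t i)) : i j / i < j} -> weak_step p q ->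
  dominated (coef_tuple C (p * t)%g) (coef_tuple C (q * t)%g).
Proof.
move=> t_mono /existsP[i /existsP[j /and3P[/eqP j_i lt_pij /eqP->]]].
apply/dominated_coef_tuple => k _.
have [E [F enumE]] : exists E, exists F, enum 'I_r = E ++ i :: j :: F.
  exists (take i (enum 'I_r)), (drop j.+1 (enum 'I_r)).
  rewrite -[LHS](cat_take_drop i); congr (_ ++ _).
  rewrite (drop_nth i) ?size_enum_ord // nth_ord_enum; congr (_ :: _).
  by rewrite -j_i (drop_nth i) ?size_enum_ord // nth_ord_enum.
have := enum_uniq 'I_r; rewrite enumE cat_uniq /= !inE negb_or.
case/and3P => _; rewrite !negb_or.
move=> /and3P[iE jE _] /and3P[/andP[ne_ij iF] jF _].
have same s : i \notin s -> j \notin s ->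
    [seq tnth C ((tperm i j * p * t)%g x) | x <- s]
      = [seq tnth C ((p * t)%g x) | x <- s].
  move=> iNs jNs; apply/eq_in_map => x xs; rewrite !permM tpermD //.
    by apply: contraNneq iNs => ->.
  by apply: contraNneq jNs => ->.
rewrite /permute_seq enumE !map_cat !map_cons !same // !permM tpermL tpermR.
apply: sorted_count_cat2l; first by rewrite /= addnCA.
by apply/sorted_count_swap/ltnW/t_mono.
Qed.

End Permutations.

Theorem theorem6p7 (r : nat) (C : r.-tuple nat)
    (C_distinct : uniq C) (C_positive : forall c, c \in C -> 0 < c) :
  exists2 le' : rel 'S_r, refinement (@weak_le r) le'
    & order_isomorphic
        (fun b b' : coef_tuples C => dominated (sval b) (sval b')) le'.
Proof.
have [t t_mono] := exists_sorting_perm C_distinct.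
pose coef (p : 'S_r) := coef_tuple C (p * t)%g.
pose le' : rel 'S_r := fun p q => dominated (coef p) (coef q).
have coef_inj : injective coef.
  by move=> p q /(coef_tuple_inj C_distinct C_positive)/mulIg.
have le'_refl : reflexive le' by move=> p; apply/forallP => i.
have le'_trans : transitive le'.
  move=> q p s /forallP pq /forallP qs; apply/forallP => i.
  exact: Order.POrderTheory.le_trans (pq i) (qs i).
exists le'.
  split; first split=> // p q /andP[/forallP pq /forallP qp].
    apply/coef_inj/eq_from_tnth => i; apply/Order.POrderTheory.le_anti.
    by rewrite pq qp.
  move=> p q /connectP[s]; elim: s p => [|p' s IHs] p /= => [_ ->//|].
  case/andP=> /(weak_step_dominated t_mono) pp' /IHs h /h.
  exact: le'_trans.
pose F (p : 'S_r) : coef_tuples C := exist _ (coef p) (codom_f _ (p * t)%g).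
pose f (b : coef_tuples C) : 'S_r := (iinv (svalP b) * t^-1)%g.
have coef_f b : coef (f b) = sval b by rewrite /coef mulgKV f_iinv.
exists f; last by move=> b b'; rewrite /le' !coef_f.
exists F => [b|p]; last by apply: coef_inj; rewrite coef_f.
exact/val_inj/coef_f.
Qed.
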